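(* Let $(X,\mathscr A,\mu)$ be a $\sigma$-finite measure space, let $\phi\colon X\to X$ and $w\colon X\to\mathbb C$ be $\mathscr A$-measurable, and assume that $C_\phi$ and $C_{\phi,w}$ are densely defined in $L^2(\mu)$. Then $$\mathcal D((C_{\phi,w}^* )^\dag)=\Big\{f\in L^2(\mu)\colon \frac{w\,(f\circ\phi)}{(\mathsf h_\phi\circ\phi)\,\mathsf E_\phi(|w|^2)}\in L^2(\mu)\Big\},$$ $$(C_{\phi,w}^* )^\dag f=\frac{w\,(f\circ\phi)}{(\mathsf h_\phi\circ\phi)\,\mathsf E_\phi(|w|^2)},\quad f\in\mathcal D((C_{\phi,w}^* )^\dag).$$
   Context: Notation: $\mathcal D(T)$, $\mathcal N(T)$, $\mathcal R(T)$ are the domain, kernel and range of an operator $T$; $L^2(\mu)$ is the complex Hilbert space of square $\mu$-integrable $\mathscr A$-measurable complex functions on $X$. Conventions: $\frac10=\infty$, $0\cdot\infty=0$. Weighted composition operators. Put $\mu_w(\sigma)=\int_\sigma|w|^2\,d\mu$ and $\mu_w\circ\phi^{-1}(\sigma)=\mu_w(\phi^{-1}(\sigma))$ for $\sigma\in\mathscr A$. If $\mu_w\circ\phi^{-1}$ is absolutely continuous with respect to $\mu$, then $C_{\phi,w}$ is said to be well-defined and is the operator in $L^2(\mu)$ with $\mathcal D(C_{\phi,w})=\{f\in L^2(\mu)\colon w\cdot(f\circ\phi)\in L^2(\mu)\}$, $C_{\phi,w}f=w\cdot(f\circ\phi)$ (it is closed). ''Densely defined'' includes being well-defined. The composition operator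 is $C_\phi:=C_{\phi,\mathbf 1}$, where $\mathbf 1$ is the constant function $1$. $\mathsf h_\phi\colon X\to[0,\infty]$ is the Radon–Nikodym derivative of $\mu\circ\phi^{-1}$: $\mu(\phi^{-1}(\Delta))=\int_\Delta\mathsf h_\phi\,d\mu$ for $\Delta\in\mathscr A$. When $C_\phi$ is densely defined, $\mathsf E_\phi(f)$ is the conditional expectation of an $\mathscr A$-measurable $f\colon X\to[0,\infty]$ with respect to the $\sigma$-algebra $\phi^{-1}(\mathscr A)$ and the measure $\mu$. Reciprocal. Let $T$ be a linear operator in a Hilbert space $\mathcal H$ with $\mathcal D(T)=\mathcal N(T)\oplus(\mathcal D(T)\cap\mathcal N(T)^\perp)$ (this holds for closed $T$). The reciprocal $T^\dag$ is the unique densely defined operator with domain $\mathcal D(T^\dag)=\mathcal R(T)\oplus\mathcal R(T)^\perp$ such that $TT^\dag f=P_{\overline{\mathcal R(T)}}f$ for $f\in\mathcal D(T^\dag)$, $T^\dag Tg=P_{\mathcal N(T)^\perp}g$ for $g\in\mathcal D(T)$, and $\mathcal N(T^\dag)=\mathcal R(T)^\perp$, where $P_M$ is the orthogonal projection onto the closed subspace $M$. *)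

(* Defs.v *)
From HB Require Import structures.
From mathcomp Require Import all_boot all_order all_algebra generic_quotient.
From mathcomp Require Import complex.
From mathcomp Require Import mathcomp_extra boolp classical_sets functions.
From mathcomp Require Import cardinality fsbigop reals ereal topology.
From mathcomp Require Import normedtype sequences measure lebesgue_measure.
From mathcomp Require Import measurable_realfun numfun lebesgue_integral.
Set Implicit Arguments.
Unset Strict Implicit.
Unset Printing Implicit Defensive.
From mathcomp Require Import ring lra.
Import Order.TTheory GRing.Theory Num.Theory.
Import numFieldNormedType.Exports.
Import ComplexField.Normc.
Local Open Scope classical_set_scope.
Local Open Scope ring_scope.

(* Linear operators, possibly unbounded and not everywhere defined, in a space
   [H] with inner product [ip] (linear in its first argument).  An operator is
   identified with its graph. *)
Section Operators.
Variables (C : numClosedFieldType) (H : lmodType C) (ip : {dot H for Num.conj}).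
Implicit Types (M N : set H) (T S : set (H * H)).

Definition hnorm (f : H) : C := sqrtC (ip f f).

Definition hclosure M : set H :=
  [set f | forall e : C, 0 < e -> exists2 g, M g & hnorm (f - g) < e].

Definition hdense M := hclosure M = setT.

Definition orthcompl M : set H := [set f | forall g, M g -> ip f g = 0].

Definition hsum M N : set H := [set f + g | f in M & g in N].

(* [g] is the orthogonal projection of [f] onto [M]. *)
Definition orthproj M (f g : H) := M g /\ orthcompl M (f - g).

Definition is_operator T :=
  [/\ T 0,
      forall (a : C) p q, T p -> T q -> T (a *: p + q) &
      forall f g g', T (f, g) -> T (f, g') -> g = g'].

Definition op_dom T : set H := [set f | exists g, T (f, g)].
Definition op_ran T : set H := [set g | exists f, T (f, g)].
Definition op_ker T : set H := [set f | T (f, 0)].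

(* Graph of an operator as soon as [op_dom T] is dense. *)
Definition adjoint T : set (H * H) :=
  [set p | forall f g, T (f, g) -> ip g p.1 = ip f p.2].

Definition is_reciprocal T S :=
  [/\ is_operator S /\ hdense (op_dom S),
      op_dom S = hsum (op_ran T) (orthcompl (op_ran T)),
      forall f u, S (f, u) ->
        exists2 v, T (u, v) & orthproj (hclosure (op_ran T)) f v,
      forall g v, T (g, v) ->
        exists2 u, S (v, u) & orthproj (orthcompl (op_ker T)) g u &
      op_ker S = orthcompl (op_ran T)].

(* The default value [set0] is not the graph of an operator. *)
Definition reciprocal T : set (H * H) := xget set0 (is_reciprocal T).

End Operators.

Section ComplexMeasurable.
Context d (X : measurableType d) (R : realType).

Definition cmeasurable (f : X -> R[i]) :=
  measurable_fun setT (fun x => complex.Re (f x)) /\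
  measurable_fun setT (fun x => complex.Im (f x)).

Definition sqint (mu : set X -> \bar R) (f : X -> R[i]) :=
  cmeasurable f /\ (\int[mu]_x (normc (f x) ^+ 2)%:E < +oo)%E.

Lemma normc2E (z : R[i]) : normc z ^+ 2 = complex.Re z ^+ 2 + complex.Im z ^+ 2.
Proof. by case: z => a b /=; rewrite sqr_sqrtr// addr_ge0// sqr_ge0. Qed.

End ComplexMeasurable.

Section SquareIntegrable.
Context d (X : measurableType d) (R : realType).
Variable mu : {measure set X -> \bar R}.
Implicit Types (u v : X -> R) (f g : X -> R[i]).

Let rsq u := measurable_fun setT u /\
  mu.-integrable setT (EFin \o (fun x => u x ^+ 2)).

Let rsqM u v : rsq u -> rsq v ->
  mu.-integrable setT (EFin \o (fun x => u x * v x)).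
Proof.
move=> [mu_ iu] [mv iv].
apply: (le_integrable measurableT _ _ (integrableD measurableT iu iv)).
  by apply/measurable_EFinP; exact: measurable_funM.
move=> x _ /=; rewrite lee_fin normrM [leRHS]ger0_norm ?addr_ge0 ?sqr_ge0//.
rewrite -(real_normK (num_real (u x))) -(real_normK (num_real (v x))).
move: `|u x| `|v x| (normr_ge0 (u x)) (normr_ge0 (v x)) => p q p0 q0.
by nra.
Qed.

Let rsqZ (a : R) u : rsq u -> rsq (fun x => a * u x).
Proof.
move=> [mu_ iu]; split; first exact: measurable_funM.
have := integrableZl measurableT (a ^+ 2) iu.
by apply: eq_integrable => // x _ /=; rewrite -EFinM exprMn.
Qed.

Let rsqD u v : rsq u -> rsq v -> rsq (fun x => u x + v x).
Proof.
move=> ru rv; have [mu_ iu] := ru; have [mv iv] := rv; split.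
  exact: measurable_funD.
have iuv := integrableZl measurableT 2 (rsqM ru rv).
have := integrableD measurableT (integrableD measurableT iu iuv) iv.
apply: eq_integrable => // x _ /=; rewrite -EFinM -!EFinD; congr EFin.
by rewrite sqrrD mulr_natl.
Qed.

Let sqintP f : sqint mu f <->
  rsq (fun x => complex.Re (f x)) /\ rsq (fun x => complex.Im (f x)).
Proof.
split=> [[[mRe mIm] foo]|[[mRe iRe] [mIm iIm]]].
  have inorm : mu.-integrable setT (fun x => (normc (f x) ^+ 2)%:E).
    apply/integrableP; split.
      apply/measurable_EFinP; under eq_fun do rewrite normc2E.
      by apply: measurable_funD; exact: measurable_funX.
    under eq_integral => x _ do rewrite gee0_abs ?lee_fin ?sqr_ge0//.
    exact: foo.
  split; split=> //; apply: (le_integrable measurableT _ _ inorm).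
  - by apply/measurable_EFinP; exact: measurable_funX.
  - move=> x _ /=; rewrite lee_fin !ger0_norm ?sqr_ge0//.
    by rewrite normc2E lerDl sqr_ge0.
  - by apply/measurable_EFinP; exact: measurable_funX.
  - move=> x _ /=; rewrite lee_fin !ger0_norm ?sqr_ge0//.
    by rewrite normc2E lerDr sqr_ge0.
split=> //.
have /integrableP[_] := integrableD measurableT iRe iIm.
congr (_ < _)%E; apply: eq_integral => x _ /=.
by rewrite normc2E ger0_norm// addr_ge0// sqr_ge0.
Qed.

Lemma sqint_lin (a : R[i]) f g : sqint mu f -> sqint mu g ->
  sqint mu (fun x => a * f x + g x).
Proof.
case: a => a b /sqintP[fRe fIm] /sqintP[gRe gIm]; apply/sqintP; split.
  rewrite (_ : (fun x => _) = (fun x =>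
      (a * complex.Re (f x) + - b * complex.Im (f x)) + complex.Re (g x))).
    by do 2 apply: (rsqD _ _) => //; exact: rsqZ.
  by apply/funext => x; case: (f x) (g x) => [? ?] [? ?] /=; rewrite mulNr.
rewrite (_ : (fun x => _) = (fun x =>
    (a * complex.Im (f x) + b * complex.Re (f x)) + complex.Im (g x))).
  by do 2 apply: (rsqD _ _) => //; exact: rsqZ.
by apply/funext => x; case: (f x) (g x) => [? ?] [? ?] /=.
Qed.

Lemma sqint0 : sqint mu (fun=> 0).
Proof.
by apply/sqintP; split; split=> //=; rewrite expr0n/=; exact: integrable0.
Qed.

Definition cintegrable f :=
  mu.-integrable setT (fun x => (complex.Re (f x))%:E) /\
  mu.-integrable setT (fun x => (complex.Im (f x))%:E).

Definition cintegral f : R[i] :=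
  Complex (\int[mu]_x complex.Re (f x)) (\int[mu]_x complex.Im (f x)).

Lemma cintegrableM f g : sqint mu f -> sqint mu g ->
  cintegrable (fun x => f x * Num.conj (g x)).
Proof.
move=> /sqintP[fRe fIm] /sqintP[gRe gIm]; split.
  have := integrableD measurableT (rsqM fRe gRe) (rsqM fIm gIm).
  apply: eq_integrable => // x _ /=; rewrite -EFinD; congr EFin.
  by case: (f x) (g x) => [? ?] [? ?] /=; rewrite mulrN opprK.
have := integrableB measurableT (rsqM fIm gRe) (rsqM fRe gIm).
apply: eq_integrable => // x _ /=; rewrite -EFinB; congr EFin.
by case: (f x) (g x) => [? ?] [? ?] /=; rewrite mulrN addrC.
Qed.

Lemma cintegral_lin (a : R[i]) f g : cintegrable f -> cintegrable g ->
  cintegral (fun x => a * f x + g x) = a * cintegral f + cintegral g.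
Proof.
case: a => a b [fRe fIm] [gRe gIm].
have Z r u := @integrableZl _ _ _ mu _ measurableT r (EFin \o u).
rewrite /cintegral -[RHS]/(Complex _ _); congr Complex.
- rewrite -(RintegralZl a measurableT fRe) -(RintegralZl b measurableT fIm).
  rewrite -RintegralB//; [|exact: (Z _ _ fRe)|exact: (Z _ _ fIm)].
  rewrite -RintegralD//; last first.
    exact: (integrableB measurableT (Z a _ fRe) (Z b _ fIm)).
  by apply: eq_Rintegral => x _; case: (f x) (g x) => [? ?] [? ?].
- rewrite -(RintegralZl a measurableT fIm) -(RintegralZl b measurableT fRe).
  rewrite -RintegralD//; [|exact: (Z _ _ fIm)|exact: (Z _ _ fRe)].
  rewrite -RintegralD//; last first.
    exact: (integrableD measurableT (Z a _ fIm) (Z b _ fRe)).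
  by apply: eq_Rintegral => x _; case: (f x) (g x) => [? ?] [? ?].
Qed.

Lemma ae_eq_cintegral f g : cintegrable f -> cintegrable g ->
  {ae mu, forall x, f x = g x} -> cintegral f = cintegral g.
Proof.
move=> [fRe fIm] [gRe gIm] fg; rewrite /cintegral /Rintegral.
congr (Complex (fine _) (fine _)); apply: ae_eq_integral => //.
- exact: measurable_int fRe.
- exact: measurable_int gRe.
- by apply: filterS fg => x /= ->.
- exact: measurable_int fIm.
- exact: measurable_int gIm.
- by apply: filterS fg => x /= ->.
Qed.

End SquareIntegrable.

Section L2.
Context d (X : measurableType d) (R : realType).
Variable mu : {measure set X -> \bar R}.

Definition sqint_pred : {pred X -> R[i]} := fun f => `[< sqint mu f >].

Record L2fun := MkL2fun { L2val :> X -> R[i]; _ : L2val \in sqint_pred }.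

HB.instance Definition _ := [isSub for L2val].
HB.instance Definition _ := [Choice of L2fun by <:].

Lemma sqint_submod_closed : submod_closed sqint_pred.
Proof.
split; first by apply/asboolP; exact: sqint0.
by move=> a f g /asboolP mf /asboolP mg; apply/asboolP; exact: sqint_lin.
Qed.

HB.instance Definition _ :=
  GRing.isSubmodClosed.Build _ _ sqint_pred sqint_submod_closed.
HB.instance Definition _ := [SubChoice_isSubLmodule of L2fun by <:].

Definition null_pred : {pred L2fun} :=
  fun f => `[< {ae mu, forall x, f x = 0} >].

Lemma null_submod_closed : submod_closed null_pred.
Proof.
split; first by apply/asboolP; exact: nearW.
move=> a f g /asboolP f0 /asboolP g0; apply/asboolP.
by apply: filterS2 f0 g0 => x fx gx; rewrite -[LHS]/(a * f x + g x) fx gx mulr0 addr0.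
Qed.

HB.instance Definition _ :=
  GRing.isSubmodClosed.Build _ _ null_pred null_submod_closed.

Local Open Scope quotient_scope.

Definition L2 := {ideal_quot null_pred}.

HB.instance Definition _ := GRing.Zmodule.on L2.
HB.instance Definition _ := EqQuotient.on L2.

Definition L2repr (F : L2) : X -> R[i] := repr F.
Coercion L2repr : L2 >-> Funclass.

Definition L2scale (a : R[i]) (F : L2) : L2 := \pi_L2 (a *: repr F).

Lemma L2_eqP (f g : L2fun) :
  \pi_L2 f = \pi_L2 g :> L2 <-> {ae mu, forall x, f x = g x}.
Proof.
apply: (iff_trans (rwP eqP)); rewrite -Quotient.idealrBE; split=> [/asboolP|fg].
  by apply: filterS => x /= /eqP; rewrite subr_eq0 => /eqP.
apply/asboolP; apply: filterS fg => x fgx.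
by rewrite -[LHS]/(f x - g x) fgx subrr.
Qed.

Lemma L2reprK (f : L2fun) : {ae mu, forall x, L2repr (\pi_L2 f) x = f x}.
Proof. by apply/L2_eqP; rewrite reprK. Qed.

Lemma L2P (F G : L2) : F = G <-> {ae mu, forall x, F x = G x}.
Proof. by have := L2_eqP (repr F) (repr G); rewrite !reprK. Qed.

Lemma sqint_L2 (F : L2) : sqint mu F.
Proof. by apply/asboolP; exact: valP (repr F). Qed.

Lemma L2reprD (F G : L2) : {ae mu, forall x, L2repr (F + G) x = F x + G x}.
Proof.
have -> : F + G = \pi_L2 (repr F + repr G) by rewrite raddfD/= !reprK.
by apply: filterS (L2reprK (repr F + repr G)) => x ->.
Qed.

Lemma L2reprZ' a (F : L2) : {ae mu, forall x, L2scale a F x = a * F x}.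
Proof. by apply: filterS (L2reprK (a *: repr F)) => x ->. Qed.

Let scaleA a b (F : L2) : L2scale a (L2scale b F) = L2scale (a * b) F.
Proof.
apply/L2P; apply: filterS3 (L2reprZ' a (L2scale b F)) (L2reprZ' b F)
  (L2reprZ' (a * b) F) => x -> -> ->.
by rewrite mulrA.
Qed.

Let scale1 : left_id 1 L2scale.
Proof.
by move=> F; apply/L2P; apply: filterS (L2reprZ' 1 F) => x ->; rewrite mul1r.
Qed.

Let scaleDr : right_distributive L2scale +%R.
Proof.
move=> a F G; apply/L2P; near=> x.
have -> : L2scale a (F + G) x = a * L2repr (F + G) x by near: x; exact: L2reprZ'.
have -> : L2repr (F + G) x = F x + G x by near: x; exact: L2reprD.
have -> : L2repr (L2scale a F + L2scale a G) x = L2scale a F x + L2scale a G x.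
  by near: x; exact: L2reprD.
have -> : L2scale a F x = a * F x by near: x; exact: L2reprZ'.
have -> : L2scale a G x = a * G x by near: x; exact: L2reprZ'.
by rewrite mulrDr.
Unshelve. all: by end_near. Qed.

Let scaleDl F : {morph L2scale^~ F : a b / a + b}.
Proof.
move=> a b; apply/L2P; near=> x.
have -> : L2scale (a + b) F x = (a + b) * F x by near: x; exact: L2reprZ'.
have -> : L2repr (L2scale a F + L2scale b F) x = L2scale a F x + L2scale b F x.
  by near: x; exact: L2reprD.
have -> : L2scale a F x = a * F x by near: x; exact: L2reprZ'.
have -> : L2scale b F x = b * F x by near: x; exact: L2reprZ'.
by rewrite mulrDl.
Unshelve. all: by end_near. Qed.

HB.instance Definition _ := GRing.Zmodule_isLmodule.Build R[i] L2
  scaleA scale1 scaleDr scaleDl.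

Lemma L2reprZ (a : R[i]) (F : L2) : {ae mu, forall x, L2repr (a *: F) x = a * F x}.
Proof. exact: L2reprZ'. Qed.

Lemma L2repr0 : {ae mu, forall x, L2repr (0 : L2) x = 0}.
Proof.
have -> : 0 = \pi_L2 0 :> L2 by rewrite raddf0.
exact: (L2reprK 0).
Qed.

Definition L2ip (F G : L2) : R[i] :=
  cintegral mu (fun x => F x * Num.conj (G x)).

Let L2ipC (F G : L2) : L2ip F G = (-1) ^+ false * Num.conj (L2ip G F).
Proof.
rewrite expr0 mul1r; rewrite /L2ip /cintegral -[RHS]/(Complex _ (- _)).
congr Complex.
  by apply: eq_Rintegral => x _; case: (F x) (G x) => [? ?] [? ?] /=; ring.
have [_ GF] := cintegrableM (sqint_L2 G) (sqint_L2 F).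
rewrite -mulN1r -RintegralZl//; apply: eq_Rintegral => x _.
by case: (F x) (G x) => [? ?] [? ?] /=; rewrite mulN1r; ring.
Qed.

Let L2ipl (K : L2) a (F G : L2) : L2ip (a *: F + G) K = a * L2ip F K + L2ip G K.
Proof.
rewrite /L2ip -cintegral_lin; [|exact: cintegrableM (sqint_L2 _) (sqint_L2 _)..].
apply: ae_eq_cintegral.
- exact: cintegrableM (sqint_L2 _) (sqint_L2 _).
- under eq_fun do rewrite mulrA -mulrDl.
  apply: cintegrableM (sqint_L2 _).
  exact: sqint_lin (sqint_L2 _) (sqint_L2 _).
near=> x.
have -> : L2repr (a *: F + G) x = L2repr (a *: F) x + G x by near: x; exact: L2reprD.
have -> : L2repr (a *: F) x = a * F x by near: x; exact: L2reprZ.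
by rewrite mulrDl mulrA.
Unshelve. all: by end_near. Qed.

Let L2ip_bilinear : bilinear_for
  (GRing.Scale.Law.clone _ _ *%R _)
  (GRing.Scale.Law.clone _ _ (Num.conj \; *%R) _) L2ip.
Proof.
split=> [K a F G|K a F G]; first exact: L2ipl.
rewrite [LHS]L2ipC [in RHS]L2ipC [L2ip K G]L2ipC !expr0 !mul1r L2ipl.
by rewrite rmorphD rmorphM.
Qed.

HB.instance Definition _ := bilinear_isBilinear.Build R[i] L2 L2 R[i]
  _ _ L2ip L2ip_bilinear.
HB.instance Definition _ := isHermitianSesquilinear.Build R[i] L2
  false Num.conj L2ip L2ipC.

Let L2ip_gt0 (F : L2) : F != 0 -> 0 < L2ip F F.
Proof.
move=> F0; have [[mRe mIm] Foo] := sqint_L2 F.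
have mF : measurable_fun setT (fun x => (normc (F x) ^+ 2)%:E).
  apply/measurable_EFinP; under eq_fun do rewrite normc2E.
  by apply: measurable_funD; exact: measurable_funX.
have F2ge0 x : (0 <= (normc (F x) ^+ 2)%:E)%E by rewrite lee_fin sqr_ge0.
have -> : L2ip F F = Complex (\int[mu]_x (normc (F x) ^+ 2)) 0.
  rewrite /L2ip /cintegral; congr Complex.
    apply: eq_Rintegral => x _; rewrite normc2E.
    by case: (F x) => ? ? /=; ring.
  rewrite (_ : (fun x => _) = cst 0); last first.
    by apply/funext => x; case: (F x) => ? ? /=; ring.
  by rewrite /Rintegral integral0.
rewrite ltcE/= eqxx/= fine_gt0// Foo andbT lt_neqAle integral_ge0// andbT.
apply: contra F0 => /eqP F0; apply/eqP/L2P.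
have : (\int[mu]_x `|(normc (F x) ^+ 2)%:E| = 0)%E.
  by rewrite F0; apply: eq_integral => x _; rewrite gee0_abs.
move=> /(ae_eq_integral_abs _ measurableT mF) N0.
apply: filterS2 N0 L2repr0 => x /(_ I)/eqP/= + ->.
by rewrite eqe sqrf_eq0 => /eqP/eq0_normc.
Qed.

HB.instance Definition _ := isDotProduct.Build R[i] L2 L2ip L2ip_gt0.
Definition L2dot : {dot L2 for Num.conj} := L2ip.
End L2.

Section WeightedComposition.
Context d (X : measurableType d) (R : realType).
Variables (mu : {measure set X -> \bar R}) (phi : X -> X).
Implicit Types (w : X -> R[i]) (h E f : X -> \bar R).

(* Absolute continuity of [mu_w \o phi^-1] with respect to [mu], where
   [mu_w] has density [|w|^2]. *)
Definition wcomp_well_defined w :=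
  (fun A : set X => \int[mu]_(x in phi @^-1` A) (normc (w x) ^+ 2)%:E)%E `<< mu.

(* Under [wcomp_well_defined w] the choice of representatives is irrelevant. *)
Definition wcomp w : set (L2 mu * L2 mu) :=
  [set p : L2 mu * L2 mu | {ae mu, forall x, p.2 x = w x * p.1 (phi x)}].

Definition wcomp_densely_defined w :=
  wcomp_well_defined w /\ hdense (L2dot mu) (op_dom (wcomp w)).

(* [h] is a version of the Radon-Nikodym derivative of [mu \o phi^-1]; it may
   take the value [+oo], and [mu \o phi^-1] need not be sigma-finite. *)
Definition is_RN_comp h :=
  [/\ measurable_fun setT h, forall x, (0 <= h x)%E &
      forall A, measurable A -> mu (phi @^-1` A) = \int[mu]_(x in A) h x]%E.

(* [E] is a version of the conditional expectation of [f] with respect to the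
   sigma-algebra of the sets [phi @^-1` A], [A] measurable. *)
Definition is_condexp f E :=
  [/\ measurable_fun setT (E : g_sigma_algebra_preimageType phi -> \bar R),
      forall x, (0 <= E x)%E &
      forall A, measurable A ->
        \int[mu]_(x in phi @^-1` A) E x = \int[mu]_(x in phi @^-1` A) f x]%E.

(* [G] is the class of [w (F \o phi) / ((h \o phi) E)].  Real and imaginary
   parts are compared in [\bar R], where [0^-1 = +oo] and [0 * +oo = 0]; in
   particular no finite value is assigned to a quotient [z / 0], [z != 0]. *)
Definition is_wquotient w h E (F G : L2 mu) :=
  {ae mu, forall x,
    (complex.Re (G x))%:E =
      ((complex.Re (w x * F (phi x))%R)%:E / (h (phi x) * E x))%E /\
    (complex.Im (G x))%:E =
      ((complex.Im (w x * F (phi x))%R)%:E / (h (phi x) * E x))%E}.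

End WeightedComposition.
Arguments wcomp {d X R} mu phi w.

(* Main.v *)
Require Import Defs.
From mathcomp Require Import all_boot all_order all_algebra complex.
From mathcomp Require Import boolp classical_sets reals ereal.
From mathcomp Require Import measure lebesgue_integral.
From mathcomp Require Import functions fsbigop normedtype sequences.
From mathcomp Require Import lebesgue_measure measurable_realfun numfun exp.
From mathcomp Require Import ring.
Import Order.TTheory GRing.Theory Num.Theory.
Import numFieldNormedType.Exports.
Import HBNNSimple.
Import ComplexField.Normc.
Set Implicit Arguments.
Unset Strict Implicit.
Unset Printing Implicit Defensive.
Local Open Scope classical_set_scope.
Local Open Scope ring_scope.

(** Write [T] for the weighted composition operator and [T*] for its adjoint.
    The proof avoids polar decompositions: it produces an explicit operator,
    checks the defining properties of a reciprocal of [T*] on it, and concludes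
    because a reciprocal is unique ([reciprocal_uniq]).

    Everything is expressed with the density [H] of the image under [phi] of
    the measure [|w|^2 mu].  The conditional expectation factors through [phi],
    [E = e \o phi] ([preimage_measurable_factor]), and [H = h e]
    ([comp_density]); so the denominator of the theorem is [H \o phi].  As the
    domain of [T] is dense, [H] is finite almost everywhere
    ([density_fin_num]); let [r] be the real function equal to it.  The change
    of variables [int |w|^2 (k \o phi) = int r k]
    ([ge0_integral_image_density]) has three consequences:
    - the function [w] vanishes almost everywhere on [r \o phi = 0], so that
      division by [r \o phi] is harmless ([pullback_density_gt0]);
    - the kernel of [T] consists of the functions carried by [r = 0];
    - for [Q F = w (F \o phi) / (r \o phi)] one has [T* (Q F) = F] on [r > 0]
      ([wquot_adjoint]), and [|Q F|^2] is the integral of [|F|^2 / r].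

    Truncation to [r >= 1 / n] makes division by [r] bounded, and truncated
    functions approximate ([L2_truncate]).  Hence the closure of the range of
    [T*] consists of the functions carried by [r > 0], its orthogonal
    complement is the kernel of [T] ([orthcompl_ran_adjoint]), and [Q F] is a
    limit of elements of the range of [T], so it is orthogonal to the kernel of
    [T*] ([wquot_orth_ker_adjoint]).

    The domain of [Q] is the main point: it has to contain the range of [T*].
    If [V = T* G], the quotient [U] of a truncation of [V] has the form [T K],
    and [<U, U> = <K, V> = <U, G>], so that [|U| <= |G|] uniformly in the
    truncation ([adjoint_quotient_bound]); monotone convergence then bounds the
    integral of [|V|^2 / r] ([adjoint_wquot]). *)

(** * Change of variables and factorization through a map *)

Lemma measurable_preimage d1 d2 (T1 : measurableType d1)
    (T2 : measurableType d2) (f : T1 -> T2) (A : set T2) :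
  measurable_fun setT f -> measurable A -> measurable (f @^-1` A).
Proof. by move=> mf mA; rewrite -[X in measurable X]setTI; exact: mf. Qed.

(** Continuity of multiplication by [c] fails in general for [c = +oo] and
    [l = 0]; here [u n <= l] forces [u = 0] in that case. *)
Lemma ge0_cvgeZl (R : realType) (c l : \bar R) (u : (\bar R)^nat) :
  (0 <= c)%E -> (forall n, 0 <= u n <= l)%E -> u @ \oo --> l ->
  (c * u n @[n --> \oo] --> c * l)%E.
Proof.
case: c => [c| |]//; first by move=> _ _ /cvgeZl; apply.
move=> _ ul cul; have [l0|l0] := leP l 0%E.
  have u0 n : u n = 0%E.
    by apply/eqP; rewrite eq_le; have /andP[-> /le_trans->] := ul n.
  have -> : l = 0%E.
    apply/eqP; rewrite eq_le l0/=.
    by have /andP[/le_trans + ul0] := ul 0; apply.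
  by under eq_fun do rewrite u0; exact: cvg_cst.
apply: (cvgeM _ (cvg_cst _) cul).
by apply: mule_def_infty_neq0; rewrite // gt_eqF.
Qed.

Section ImageDensity.
Context d1 d2 (T1 : measurableType d1) (T2 : measurableType d2) (R : realType).
Variables (m1 : {measure set T1 -> \bar R}) (m2 : {measure set T2 -> \bar R}).
Variables (phi : T1 -> T2) (a : T1 -> \bar R) (H : T2 -> \bar R).
Local Open Scope ereal_scope.
Hypotheses (mphi : measurable_fun setT phi) (ma : measurable_fun setT a)
  (mH : measurable_fun setT H) (a0 : forall x, 0 <= a x)
  (H0 : forall y, 0 <= H y).
Hypothesis aH : forall A, measurable A ->
  \int[m1]_(x in phi @^-1` A) a x = \int[m2]_(y in A) H y.

Let mcomp (k : T2 -> \bar R) : measurable_fun setT k ->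
  measurable_fun setT (k \o phi).
Proof. by move=> mk; apply: measurableT_comp. Qed.

Let nnsfun_image_density (g : {nnsfun T2 >-> R}) :
  \int[m1]_x (a x * (g (phi x))%:E) = \int[m2]_y (H y * (g y)%:E).
Proof.
have mpre y : measurable (g @^-1` [set y]) by [].
have gE y : (g y)%:E = \sum_(c \in range g) (c * \1_(g @^-1` [set c]) y)%:E.
  by rewrite fimfunE -fsumEFin.
have geF c y : 0 <= (c * \1_(g @^-1` [set c]) y)%:E.
  rewrite lee_fin indicE; case: (boolP (y \in _)); last by rewrite mulr0.
  by rewrite inE => <-; rewrite mulr1.
have mF c : measurable_fun setT (fun y => (c * \1_(g @^-1` [set c]) y)%:E).
  by apply/measurable_EFinP; apply: measurable_funM.
under eq_integral => x _ do rewrite gE ge0_mule_fsumr//.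
under [RHS]eq_integral => x _ do rewrite gE ge0_mule_fsumr//.
rewrite ge0_integral_fsum//; last 2 first.
- by move=> c; apply: emeasurable_funM => //; exact: (mcomp (mF c)).
- by move=> c x _; apply: mule_ge0.
rewrite ge0_integral_fsum//; last 2 first.
- by move=> c; apply: emeasurable_funM.
- by move=> c x _; apply: mule_ge0.
apply: eq_fsbigr => c; rewrite inE => -[z _ gzc].
have c0 : 0 <= c%:E by rewrite -gzc lee_fin.
have mi A (mA : measurable A) :
    measurable_fun [set: T2] (fun y : T2 => (\1_A y : R)%:E).
  by apply/measurable_EFinP; exact: measurable_indic.
under eq_integral => x _ do rewrite EFinM muleCA.
under [RHS]eq_integral => x _ do rewrite EFinM muleCA.
rewrite ge0_integralZl//; last 2 first.
- by apply: emeasurable_funM => //; exact: (mcomp (mi _ _)).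
- by move=> x _; rewrite mule_ge0// lee_fin.
rewrite ge0_integralZl//; last 2 first.
- by apply: emeasurable_funM => //; apply: (mi _ _).
- by move=> x _; rewrite mule_ge0// lee_fin.
congr (_ * _).
have := aH (mpre c); rewrite integral_mkcond [RHS]integral_mkcond.
under eq_integral do rewrite epatch_indic.
by under [RHS]eq_integral do rewrite epatch_indic.
Qed.

(** The hypothesis [aH] is this identity for indicator functions; it extends
    to simple functions by linearity and to [k] by monotone convergence.  The
    densities [a] and [H] may take the value [+oo]. *)
Lemma ge0_integral_image_density (k : T2 -> \bar R) :
  measurable_fun setT k -> (forall y, 0 <= k y) ->
  \int[m1]_x (a x * k (phi x)) = \int[m2]_y (H y * k y).
Proof.
move=> mk k0; pose g := nnsfun_approx measurableT mk.
have g_cvg y : EFin \o g^~ y @ \oo --> k y.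
  by apply: cvg_nnsfun_approx => // z _.
have mg n : measurable_fun setT (EFin \o g n) by apply/measurable_EFinP.
have g_nd y : {homo (fun n => (g n y)%:E) : i j / (i <= j)%N >-> i <= j}.
  by move=> i j ij; rewrite lee_fin; apply/lefP/nd_nnsfun_approx.
have g_le n y : 0 <= (g n y)%:E <= k y.
  rewrite lee_fin fun_ge0/= -(cvg_lim _ (g_cvg y))//.
  apply: lime_ge; first by apply/cvg_ex; exists (k y); exact: g_cvg.
  by exists n => // i /= ni; exact: g_nd.
have c1 : \int[m1]_x (a x * (g n (phi x))%:E) @[n --> \oo] -->
    \int[m1]_x (a x * k (phi x)).
  have -> : \int[m1]_x (a x * k (phi x)) =
      \int[m1]_x limn (fun n => a x * (g n (phi x))%:E).
    apply: eq_integral => x _; apply/esym/cvg_lim => //.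
    exact: ge0_cvgeZl (a0 x) (g_le^~ _) (g_cvg _).
  apply: cvg_monotone_convergence => //.
  - by move=> n; apply: emeasurable_funM => //; exact: (mcomp (mg n)).
  - by move=> n x _; rewrite mule_ge0// lee_fin.
  - by move=> x _ i j ij; rewrite lee_wpmul2l// g_nd.
have c2 : \int[m2]_x (H x * (g n x)%:E) @[n --> \oo] -->
    \int[m2]_x (H x * k x).
  have -> : \int[m2]_x (H x * k x) =
      \int[m2]_x limn (fun n => H x * (g n x)%:E).
    apply: eq_integral => x _; apply/esym/cvg_lim => //.
    exact: ge0_cvgeZl (H0 x) (g_le^~ _) (g_cvg _).
  apply: cvg_monotone_convergence => //.
  - by move=> n; apply: emeasurable_funM => //; exact: mg.
  - by move=> n x _; rewrite mule_ge0// lee_fin.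
  - by move=> x _ i j ij; rewrite lee_wpmul2l// g_nd.
apply: (cvg_unique _ c1) => //.
by rewrite (funext (fun n => nnsfun_image_density (g n))).
Qed.

End ImageDensity.

(** The Doob-Dynkin factorization.  Each level set [E > q], [q] a nonnegative
    rational, is the preimage of a measurable set [B q], and [e] is the
    supremum of the functions equal to [q] on [B q] and to [0] elsewhere. *)
Lemma preimage_measurable_factor d (T1 : pointedType) (T2 : measurableType d)
    (R : realType) (phi : T1 -> T2) (E : T1 -> \bar R) :
  measurable_fun setT (E : g_sigma_algebra_preimageType phi -> \bar R) ->
  (forall x, 0 <= E x)%E ->
  exists e : T2 -> \bar R, [/\ measurable_fun setT e, forall y, (0 <= e y)%E &
    E = e \o phi].
Proof.
move=> mE E0.
(* an enumeration of the nonnegative rationals *)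
pose q n : R := if unpickle n is Some r then `|ratr r| else 0.
have q0 n : 0 <= q n by rewrite /q; case: unpickle.
have /choice[B BP] n : exists B : set T2, measurable B /\
    phi @^-1` B = [set x | (q n)%:E < E x]%E.
  have [B mB] := emeasurable_fun_o_infty measurableT mE (q n)%:E.
  by rewrite !setTI => BE; exists B.
pose f n y : \bar R := (q n * \1_(B n) y)%:E.
have e0 y : (0 <= esups (f^~ y) 0%N)%E.
  apply: (@le_trans _ _ (f 0%N y)); first by rewrite /f lee_fin mulr_ge0.
  by apply: ereal_sup_ubound; exists 0%N.
exists (fun y => esups (f^~ y) 0%N); split.
- apply: measurable_fun_esups => n; apply/measurable_EFinP.
  by apply: measurable_funM => //; apply: measurable_indic; case: (BP n).
- exact: e0.
apply/funext => x /=; apply/eqP; rewrite eq_le; apply/andP; split.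
  rewrite leNgt; apply/negP => fE.
  have f0 := e0 (phi x).
  have [r /andP[fr rE]] : exists r : rat,
      (esups (f^~ (phi x)) 0%N < (ratr r)%:E < E x)%E.
    move: fE f0; case: (esups _ _) => [s| |]// + _; case: (E x) => [t| |]//.
      rewrite lte_fin => /rat_in_itvoo[r]; rewrite in_itv/= => /andP[sr rt].
      by exists r; rewrite !lte_fin sr.
    move=> _; have /rat_in_itvoo[r] : s < s + 1 by rewrite ltrDl.
    by rewrite in_itv/= => /andP[sr _]; exists r; rewrite lte_fin sr ltry.
  have r0 : 0 <= ratr r :> R by rewrite -lee_fin (le_trans f0)// ltW.
  have qr : q (pickle r) = ratr r by rewrite /q pickleK ger0_norm.
  have [_ Bn] := BP (pickle r).
  have : (ratr r)%:E = f (pickle r) (phi x).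
    rewrite /f qr indicE mem_set ?mulr1//.
    suff : (phi @^-1` B (pickle r)) x by [].
    by rewrite Bn/= qr.
  move=> rf; move: fr; rewrite ltNge rf => /negP; apply.
  by apply: ereal_sup_ubound; exists (pickle r).
apply: ge_ereal_sup => _ [n _ <-]; rewrite /f.
have [_ Bn] := BP n.
rewrite indicE; case: (boolP (_ \in _)); last by rewrite mulr0.
rewrite inE mulr1 => Bx; apply/ltW.
suff : [set x | (q n)%:E < E x]%E x by [].
by rewrite -Bn.
Qed.

(** * Uniqueness of the reciprocal *)

Section InnerProduct.
Variables (C : numClosedFieldType) (H : lmodType C) (ip : {dot H for Num.conj}).
Implicit Types (M : set H) (T S : set (H * H)) (f g u v : H).

Lemma ip_sym u v : ip u v = Num.conj (ip v u).
Proof. by rewrite hermC expr0 mul1r. Qed.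

Lemma ip_sym0 u v : ip u v = 0 -> ip v u = 0.
Proof. by move=> uv; rewrite ip_sym uv rmorph0. Qed.

Lemma ip_proj_le u v : ip u (v - u) = 0 -> ip u u <= ip v v.
Proof.
by move=> /hnormDd; rewrite addrC subrK => ->; rewrite lerDl dnorm_ge0.
Qed.

Lemma cauchy_schwarz u v : `|ip u v| <= hnorm ip u * hnorm ip v.
Proof.
have [->|v0] := eqVneq v 0.
  by rewrite linear0r normr0 mulr_ge0// sqrtC_ge0 dnorm_ge0.
rewrite /hnorm -sqrtCM ?nnegrE ?dnorm_ge0// -(sqrCK (normr_ge0 _)).
rewrite ler_sqrtC ?nnegrE ?mulr_ge0 ?exprn_ge0 ?dnorm_ge0//.
have vv0 : 0 < ip v v by rewrite dnorm_gt0.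
pose a := ip u v / ip v v.
have : ip (a *: v) (u - a *: v) = 0.
  apply: ip_sym0; rewrite linearZr_LR/= linearBl/= linearZl_LR/=.
  by rewrite divfK ?gt_eqF// subrr mulr0.
have -> : ip u v = a * ip v v by rewrite divfK ?gt_eqF.
move=> /ip_proj_le; rewrite dnormZ.
rewrite [X in _ -> X ^+ 2 <= _]normrM (gtr0_norm vv0) exprMn.
by rewrite [ip v v ^+ 2]expr2 mulrA ler_pM2r.
Qed.

Lemma sub_hclosure M : M `<=` hclosure ip M.
Proof.
by move=> f Mf e e0; exists f; rewrite // subrr /hnorm linear0l sqrtC0.
Qed.

Lemma orthcompl_hclosure M f :
  orthcompl ip M f -> orthcompl ip (hclosure ip M) f.
Proof.
move=> fM g gM; apply/eqP; apply: contraT => fg.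
(* adding [1] covers the case [f = 0] *)
have f0 : 0 < hnorm ip f + 1 by rewrite ltr_wpDl// sqrtC_ge0 dnorm_ge0.
have [k Mk gk] : exists2 k, M k &
    hnorm ip (g - k) < `|ip f g| / (hnorm ip f + 1).
  by apply: gM; rewrite divr_gt0 ?normr_gt0.
have fgk : ip f g = ip f (g - k) by rewrite linearBr/= (fM _ Mk) subr0.
have := cauchy_schwarz f (g - k); rewrite -fgk => fgle.
have : `|ip f g| < `|ip f g|; last by rewrite ltxx.
rewrite ltr_pdivlMr// mulrC in gk; apply: le_lt_trans gk.
by rewrite (le_trans fgle)// ler_wpM2r ?lerDl ?ler01// sqrtC_ge0 dnorm_ge0.
Qed.

Lemma hdense_orthcompl0 M f : hdense ip M -> orthcompl ip M f -> f = 0.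
Proof.
move=> dM /orthcompl_hclosure fM; apply/eqP; rewrite -(dnorm_eq0 ip).
by apply/eqP/fM; rewrite dM.
Qed.

Lemma orthproj_uniq M f u v : orthproj ip M f u -> orthproj ip M f v -> u = v.
Proof.
move=> [Mu fu] [Mv fv]; apply/eqP; rewrite -subr_eq0 -(dnorm_eq0 ip); apply/eqP.
have uvE : u - v = (f - v) - (f - u) by rewrite opprB [RHS]addrC addrA subrK.
rewrite [X in ip X]uvE linearBl/= !linearBr/=.
by rewrite (fu _ Mu) (fu _ Mv) (fv _ Mu) (fv _ Mv) !subrr.
Qed.

Lemma adjoint_lin T (a : C) p q :
  adjoint ip T p -> adjoint ip T q -> adjoint ip T (a *: p + q).
Proof.
move=> Tp Tq f g fg /=; rewrite !linearDr/= !linearZr_LR/=.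
by rewrite (Tp _ _ fg) (Tq _ _ fg).
Qed.

Lemma ker_adjoint_ran T z v :
  op_ker T z -> op_ran (adjoint ip T) v -> ip z v = 0.
Proof. by move=> Tz [u /(_ _ _ Tz)/= <-]; rewrite linear0l. Qed.

(** The part [f - v] of [f] orthogonal to the range of [T] is in the kernel of
    [S], so [u] is also the value of [S] at [v]; and [S] maps [v = T u] to the
    projection of [u] onto the orthogonal complement of the kernel of [T]. *)
Lemma orthcompl_ker_range T S f u : is_reciprocal ip T S -> S (f, u) ->
  orthcompl ip (op_ker T) u.
Proof.
move=> [[[S0 Slin Sfun] dS] domS S3 S4 kerS] fu.
have [v uv [_ fv]] := S3 _ _ fu.
have ranT : op_ran T v by exists u.
have Sfv : S (f - v, 0).
  suff : op_ker S (f - v) by [].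
  by rewrite kerS => g Tg; apply: fv; exact: sub_hclosure.
have [u' vu' [pu' _]] := S4 _ _ uv.
have Sfu' : S (f, u').
  have := Slin 1 _ _ Sfv vu'.
  by rewrite scale1r -[X in S X]/(f - v + v, 0 + u') subrK add0r.
by rewrite (Sfun _ _ _ fu Sfu').
Qed.

(** If [S f = u] and [S' f = u'] then [T u = T u'] is the projection of [f]
    onto the closed range of [T], so that [u - u'] is in the kernel of [T] and
    orthogonal to it. *)
Lemma reciprocal_uniq T S S' :
  (forall p q, T p -> T q -> T (p - q)) ->
  is_reciprocal ip T S -> is_reciprocal ip T S' -> S = S'.
Proof.
move=> TB; wlog suff sub : S S' / is_reciprocal ip T S ->
    is_reciprocal ip T S' -> S `<=` S'.
  by move=> rS rS'; apply/seteqP; split; apply: sub.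
move=> rS rS' [f u] fu.
have [_ domS S3 _ _] := rS; have [_ domS' S3' _ _] := rS'.
have [u' fu'] : op_dom S' f by rewrite domS' -domS; exists u.
have [v uv pv] := S3 _ _ fu; have [v' uv' pv'] := S3' _ _ fu'.
have vv' := orthproj_uniq pv pv'; rewrite -vv' in uv'.
suff -> : u = u' by [].
apply/eqP; rewrite -subr_eq0 -(dnorm_eq0 ip); apply/eqP.
have kuu' : op_ker T (u - u').
  by have := TB _ _ uv uv'; rewrite -[X in T X]/(u - u', v - v) subrr.
rewrite linearBl/= (orthcompl_ker_range rS fu kuu').
by rewrite (orthcompl_ker_range rS' fu' kuu') subrr.
Qed.

End InnerProduct.

(** * Norms, inner products and truncations in [L2] *)

Section L2Facts.
Local Open Scope complex_scope.
Context d (X : measurableType d) (R : realType).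
Variable mu : {measure set X -> \bar R}.
Implicit Types (f g : X -> R[i]) (F G U V : L2 mu) (c : X -> R).

Lemma normc_sqr (z : R[i]) : (normc z ^+ 2)%:C = z * Num.conj z.
Proof. by rewrite normc2E; case: z => a b; congr Complex => /=; ring. Qed.

Lemma cmeasurableM f g : cmeasurable f -> cmeasurable g ->
  cmeasurable (fun x => f x * g x).
Proof.
move=> [fR fI] [gR gI]; split.
  rewrite (_ : (fun x => _) = (fun x => complex.Re (f x) * complex.Re (g x) -
      complex.Im (f x) * complex.Im (g x))).
    by apply: measurable_funB; apply: measurable_funM.
  by apply/funext => x; case: (f x) (g x) => [? ?] [? ?].
rewrite (_ : (fun x => _) = (fun x => complex.Re (f x) * complex.Im (g x) +
    complex.Im (f x) * complex.Re (g x))).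
  by apply: measurable_funD; apply: measurable_funM.
by apply/funext => x; case: (f x) (g x) => [? ?] [? ?].
Qed.

Lemma cmeasurable_conj f : cmeasurable f ->
  cmeasurable (fun x => Num.conj (f x)).
Proof.
move=> [fR fI]; split.
  by rewrite (_ : (fun x => _) = (fun x => complex.Re (f x)))//;
    apply/funext => x; case: (f x).
rewrite (_ : (fun x => _) = (fun x => - complex.Im (f x))).
  exact: measurableT_comp.
by apply/funext => x; case: (f x).
Qed.

Lemma cmeasurable_real c : measurable_fun setT c ->
  cmeasurable (fun x => (c x)%:C).
Proof. by move=> mc; split => //=; exact: measurable_cst. Qed.

Lemma cmeasurable_comp (phi : X -> X) f : measurable_fun setT phi ->
  cmeasurable f -> cmeasurable (fun x => f (phi x)).
Proof.
move=> mphi [fR fI]; split.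
  exact: (measurableT_comp fR).
exact: (measurableT_comp fI).
Qed.

Lemma cmeasurable_L2 F : cmeasurable F.
Proof. by case: (sqint_L2 F). Qed.

Lemma measurable_normc2 f : cmeasurable f ->
  measurable_fun setT (fun x => (normc (f x) ^+ 2)%:E).
Proof.
move=> [fR fI]; apply/measurable_EFinP; under eq_fun do rewrite normc2E.
by apply: measurable_funD; apply: measurable_funX.
Qed.

Lemma L2_exists f : sqint mu f -> exists F, {ae mu, forall x, F x = f x}.
Proof.
move=> sf; have fP : f \in sqint_pred mu by apply/asboolP.
by exists (\pi_(L2 mu) (MkL2fun fP))%qT; exact: (L2reprK (MkL2fun fP)).
Qed.

Lemma L2repr_lin (a : R[i]) F G :
  {ae mu, forall x, L2repr (a *: F + G) x = a * F x + G x}.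
Proof.
by apply: filterS2 (L2reprD (a *: F) G) (L2reprZ a F) => x -> ->.
Qed.

Lemma L2reprB F G : {ae mu, forall x, L2repr (F - G) x = F x - G x}.
Proof.
rewrite addrC -scaleN1r; apply: filterS (L2repr_lin (-1) G F) => x ->.
by rewrite mulN1r addrC.
Qed.

(** With the conventions for divergent integrals, the integral depends only on
    the class of a measurable function, integrable or not. *)
Lemma cmeasurable_ae_cintegral f g : cmeasurable f -> cmeasurable g ->
  {ae mu, forall x, f x = g x} -> cintegral mu f = cintegral mu g.
Proof.
move=> [fR fI] [gR gI] fg; rewrite /cintegral /Rintegral.
congr (Complex (fine _) (fine _)); apply: ae_eq_integral => //;
  by [exact/measurable_EFinP|apply: filterS fg => x /= ->].
Qed.

Lemma L2ipE F G f : cmeasurable f ->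
  {ae mu, forall x, F x * Num.conj (G x) = f x} ->
  L2dot mu F G = cintegral mu f.
Proof.
move=> mf FGf; apply: cmeasurable_ae_cintegral => //.
by apply: cmeasurableM; [|apply: cmeasurable_conj]; exact: cmeasurable_L2.
Qed.

Lemma L2_sqnormE F f : cmeasurable f -> {ae mu, forall x, F x = f x} ->
  L2dot mu F F = (fine (\int[mu]_x (normc (f x) ^+ 2)%:E))%:C.
Proof.
move=> mf Ff; rewrite (@L2ipE _ _ (fun x => (normc (f x) ^+ 2)%:C)); first last.
- by apply: filterS Ff => x ->; rewrite normc_sqr.
- by apply: cmeasurable_real; apply/measurable_EFinP; exact: measurable_normc2.
rewrite /cintegral/= -[RHS]/(Complex _ _); congr Complex.
by rewrite /Rintegral integral0.
Qed.

Lemma L2_sqnorm_fin F f : cmeasurable f -> {ae mu, forall x, F x = f x} ->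
  (\int[mu]_x (normc (f x) ^+ 2)%:E < +oo)%E.
Proof.
move=> mf Ff; have [_] := sqint_L2 F; congr (_ < _)%E.
apply: ae_eq_integral => //; [exact/measurable_normc2/cmeasurable_L2|
  exact: measurable_normc2|by apply: filterS Ff => x ->].
Qed.

Lemma cmeasurable_if (D : X -> bool) f :
  measurable_fun setT D -> cmeasurable f ->
  cmeasurable (fun x => if D x then f x else 0).
Proof.
move=> mD [fR fI]; split.
  under eq_fun do rewrite [complex.Re _]fun_if; exact: measurable_fun_ifT.
by under eq_fun do rewrite [complex.Im _]fun_if; exact: measurable_fun_ifT.
Qed.

Lemma sqint_if (D : X -> bool) f : measurable_fun setT D -> sqint mu f ->
  sqint mu (fun x => if D x then f x else 0).
Proof.
move=> mD [mf foo]; have mDf := cmeasurable_if mD mf; split => //.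
apply: le_lt_trans foo; apply: ge0_le_integral => //.
- by move=> x _; rewrite lee_fin sqr_ge0.
- exact: measurable_normc2.
- exact: measurable_normc2.
move=> x _; rewrite lee_fin; case: (D x) => //.
by rewrite normc0 expr0n sqr_ge0.
Qed.

Lemma L2_bounded_weight c (B : R) F : measurable_fun setT c ->
  (forall x, 0 <= c x) -> 0 <= B ->
  {ae mu, forall x, F x = 0 \/ c x <= B} ->
  (\int[mu]_x (c x * normc (F x) ^+ 2)%:E < +oo)%E.
Proof.
move=> mc c0 B0 cB; have mF := measurable_normc2 (cmeasurable_L2 F).
apply: (@le_lt_trans _ _ (\int[mu]_x (B * normc (F x) ^+ 2)%:E)%E).
  apply: ae_ge0_le_integral => //.
  - by move=> x _; rewrite lee_fin mulr_ge0// sqr_ge0.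
  - by apply/measurable_EFinP/measurable_funM => //; exact/measurable_EFinP.
  - by move=> x _; rewrite lee_fin mulr_ge0// sqr_ge0.
  - by apply/measurable_EFinP/measurable_funM => //; exact/measurable_EFinP.
  apply: filterS cB => x [->|cxB] _; first by rewrite normc0 expr0n !mulr0.
  by rewrite lee_fin ler_wpM2r// sqr_ge0.
under eq_integral do rewrite EFinM.
rewrite ge0_integralZl_EFin//; last by move=> x _; rewrite lee_fin sqr_ge0.
by rewrite lte_mul_pinfty ?lee_fin//; case: (sqint_L2 F).
Qed.

Lemma near_inv_le (t : R) : 0 < t -> \forall n \near \oo, n.+1%:R^-1 <= t.
Proof.
move=> t0; near=> n; rewrite -[leRHS]invrK lef_pV2 ?posrE ?invr_gt0//.
apply: ltW; apply: lt_le_trans (truncnS_gt _) _; rewrite ler_nat ltnS.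
by near: n; exact: nbhs_infty_ge.
Unshelve. all: by end_near. Qed.

(** Truncating [F] to the sets [n.+1%:R^-1 <= c], which exhaust the support of
    [F], approximates [F] in norm, by dominated convergence. *)
Lemma L2_truncate c F : measurable_fun setT c ->
  {ae mu, forall x, F x = 0 \/ 0 < c x} ->
  forall e : R[i], 0 < e -> exists n, forall V,
    {ae mu, forall x, V x = if n.+1%:R^-1 <= c x then F x else 0} ->
    hnorm (L2dot mu) (F - V) < e.
Proof.
move=> mc Fc e e0.
have [ei er] : complex.Im e = 0 /\ 0 < complex.Re e.
  by move: e0; rewrite ltcE/= => /andP[/eqP].
have mD n : measurable_fun setT (fun x => ~~ (n.+1%:R^-1 <= c x)).
  by apply: measurable_neg; exact: measurable_fun_ler.
pose tail n x := if ~~ (n.+1%:R^-1 <= c x) then F x else 0.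
have mtail n : cmeasurable (tail n).
  by apply: cmeasurable_if => //; exact: cmeasurable_L2.
have mF := measurable_normc2 (cmeasurable_L2 F).
have : (\int[mu]_x (normc (tail n x) ^+ 2)%:E @[n --> \oo] --> 0)%E.
  have [||||| _ _] := @dominated_convergence _ _ _ mu setT measurableT
    (fun n x => (normc (tail n x) ^+ 2)%:E) (cst 0%E)
    (fun x => (normc (F x) ^+ 2)%:E).
  - by move=> n; exact: measurable_normc2.
  - exact: measurable_cst.
  - apply: filterS Fc => x Fcx _; apply: cvg_near_cst.
    rewrite /tail; case: Fcx => [->|/near_inv_le].
      by apply: nearW => n; rewrite if_same normc0 expr0n.
    by apply: filterS => n ->; rewrite normc0 expr0n.
  - apply/integrableP; split => //.
    under eq_integral do rewrite gee0_abs ?lee_fin ?sqr_ge0//.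
    by case: (sqint_L2 F).
  - apply: nearW => x n _; rewrite gee0_abs ?lee_fin ?sqr_ge0// /tail.
    by case: ifP => // _; rewrite normc0 expr0n sqr_ge0.
  by rewrite integral0.
move=> /fine_cvgP[_] /cvgrPdist_lt/(_ (complex.Re e ^+ 2)).
rewrite exprn_gt0// => /(_ isT)[n _ /(_ n (leqnn n))/=].
rewrite sub0r normrN => nlt; exists n => V FV.
have -> : e = sqrtC (e ^+ 2) by rewrite sqrCK// ltW.
rewrite /hnorm ltr_sqrtC ?nnegrE ?dnorm_ge0 ?exprn_ge0 ?(ltW e0)//.
rewrite (@L2_sqnormE _ (tail n))//; last first.
  apply: filterS2 (L2reprB F V) FV => x -> ->.
  by rewrite /tail; case: ifP => _; rewrite ?subr0 ?subrr.
have -> : e = (complex.Re e)%:C by move: ei; case: (e) => ? ? /= ->.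
by rewrite -rmorphXn/= ltcR (le_lt_trans (ler_norm _) nlt).
Qed.

End L2Facts.

(** * The reciprocal of the adjoint, for a real density *)

Section PullbackDensity.
Local Open Scope complex_scope.
Context d (X : measurableType d) (R : realType).
Variables (mu : {measure set X -> \bar R}) (phi : X -> X) (w : X -> R[i]).
Variable r : X -> R.
Implicit Types (f k : X -> R[i]) (F G U V : L2 mu).
Hypotheses (mphi : measurable_fun setT phi) (mw : cmeasurable w)
  (mr : measurable_fun setT r) (r0 : forall x, 0 <= r x).
Hypothesis wr : forall A, measurable A ->
  (\int[mu]_(x in phi @^-1` A) (normc (w x) ^+ 2)%:E =
   \int[mu]_(x in A) (r x)%:E)%E.

Let mw2 := measurable_normc2 mw.

Lemma weight_null A : measurable A -> (\int[mu]_(x in A) (r x)%:E = 0)%E ->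
  {ae mu, forall x, phi x \in A -> w x = 0}.
Proof.
move=> mA; rewrite -wr// => wA0.
have mpA := measurable_preimage mphi mA.
have mw2A := measurable_funS measurableT (@subsetT _ (phi @^-1` A)) mw2.
have : (\int[mu]_(x in phi @^-1` A) `|(normc (w x) ^+ 2)%:E| = 0)%E.
  rewrite -[RHS]wA0; apply: eq_integral => x _.
  by rewrite gee0_abs// lee_fin sqr_ge0.
move=> /(ae_eq_integral_abs _ mpA mw2A); apply: filterS => x wx.
by rewrite inE => /wx/eqP; rewrite eqe sqrf_eq0 => /eqP/eq0_normc.
Qed.

(** Almost everywhere properties pull back along [phi] only off the zeros of
    [w]; this is what makes the formulas below independent of the choice of
    representatives. *)
Lemma pullback_ae (P : X -> Prop) : {ae mu, forall x, P x} ->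
  {ae mu, forall x, w x = 0 \/ P (phi x)}.
Proof.
move=> [A [mA A0 PA]].
have : (\int[mu]_(x in A) (r x)%:E = 0)%E.
  apply: null_set_integral => //; apply/measurable_EFinP.
  exact: measurable_funS mr.
move=> /(weight_null mA); apply: filterS => x.
have [_ ->//|xA _] := boolP (phi x \in A); first by left.
right; apply: contrapT => nP; move: xA; rewrite notin_setE; apply.
exact: PA.
Qed.

(** The integral of [|w|^2] over the preimage of [r = 0] is the integral of
    [r] over [r = 0]. *)
Lemma pullback_density_gt0 : {ae mu, forall x, w x = 0 \/ 0 < r (phi x)}.
Proof.
pose Z := [set x | r x = 0].
have mZ : measurable Z by exact: (measurable_preimage mr (measurable_set1 0)).
have : (\int[mu]_(x in Z) (r x)%:E = 0)%E.
  by apply: integral0_eq => x /= ->.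
move=> /(weight_null mZ); apply: filterS => x.
have [_ ->//|xA _] := boolP (phi x \in Z); first by left.
right; rewrite lt_neqAle r0 andbT eq_sym; apply/eqP => rx.
by move: xA; rewrite notin_setE; apply.
Qed.

Let integral_pullback_ge0 (k : X -> \bar R) : measurable_fun setT k ->
  (forall x, 0 <= k x)%E ->
  (\int[mu]_x ((normc (w x) ^+ 2)%:E * k (phi x)) =
   \int[mu]_x ((r x)%:E * k x))%E.
Proof.
move=> mk k0; apply: (ge0_integral_image_density mphi) => //.
- exact/measurable_EFinP.
- by move=> x; rewrite lee_fin sqr_ge0.
Qed.

Let integral_pullback (k : X -> R) : measurable_fun setT k ->
  (\int[mu]_x (normc (w x) ^+ 2 * k (phi x))%:E = \int[mu]_x (r x * k x)%:E)%E.
Proof.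
move=> mk.
have posE (c t : R) : 0 <= c ->
    (maxe (c * t)%:E 0 = c%:E * maxe t%:E 0 /\
     maxe (- (c * t)%:E) 0 = c%:E * maxe (- t%:E) 0)%E.
  move=> c0; rewrite -!EFinN -!EFin_max -!EFinM.
  by rewrite !maxr_pMr// !mulr0 mulrN.
rewrite integralE [RHS]integralE; congr (_ - _)%E.
- under eq_integral do rewrite funeposE (posE _ _ (sqr_ge0 _)).1.
  under [RHS]eq_integral do rewrite funeposE (posE _ _ (r0 _)).1.
  apply: integral_pullback_ge0 (fun y => maxe (k y)%:E 0%E) _ _.
  + by apply: measurable_maxe => //; exact/measurable_EFinP.
  + by move=> x; rewrite le_max lexx orbT.
- under eq_integral do rewrite funenegE (posE _ _ (sqr_ge0 _)).2.
  under [RHS]eq_integral do rewrite funenegE (posE _ _ (r0 _)).2.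
  apply: integral_pullback_ge0 (fun y => maxe (- (k y)%:E) 0)%E _ _.
  + apply: measurable_maxe => //; apply: measurableT_comp => //.
    exact/measurable_EFinP.
  + by move=> x; rewrite le_max lexx orbT.
Qed.

Lemma cintegral_pullback k : cmeasurable k ->
  cintegral mu (fun x => (normc (w x) ^+ 2)%:C * k (phi x)) =
  cintegral mu (fun x => (r x)%:C * k x).
Proof.
move=> [mRe mIm]; rewrite /cintegral /Rintegral.
have ReE (c : R) (z : R[i]) : complex.Re (c%:C * z) = c * complex.Re z.
  by case: z => a b /=; rewrite mul0r subr0.
have ImE (c : R) (z : R[i]) : complex.Im (c%:C * z) = c * complex.Im z.
  by case: z => a b /=; rewrite mul0r addr0.
congr (Complex (fine _) (fine _)).
- under eq_integral do rewrite ReE; under [RHS]eq_integral do rewrite ReE.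
  exact: (integral_pullback mRe).
- under eq_integral do rewrite ImE; under [RHS]eq_integral do rewrite ImE.
  exact: (integral_pullback mIm).
Qed.

Lemma integral_pullback_normc2 k : cmeasurable k ->
  (\int[mu]_x (normc (w x * k (phi x)) ^+ 2)%:E =
   \int[mu]_x (r x * normc (k x) ^+ 2)%:E)%E.
Proof.
move=> mk; under eq_integral do rewrite normcM exprMn.
apply: (integral_pullback (k := fun x => normc (k x) ^+ 2)).
exact/measurable_EFinP/measurable_normc2.
Qed.

Let T := wcomp mu phi w.

(** Where [r \o phi = 0] the inverse is [0], a harmless value because [w = 0]
    almost everywhere there. *)
Definition wquot : set (L2 mu * L2 mu) := [set p : L2 mu * L2 mu |
  {ae mu, forall x, p.2 x = w x * (((r (phi x))^-1)%:C * p.1 (phi x))}].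

Let divr (F : X -> R[i]) x := ((r x)^-1)%:C * F x.

Let mVr : measurable_fun setT (fun x => (r x)^-1).
Proof.
(* inversion is the power [-1] on nonnegative reals, [0] included *)
rewrite (_ : (fun x => _) = (@powR R ^~ (-1)) \o r).
  exact: (measurableT_comp (measurable_powR (-1)) mr).
by apply/funext => x /=; rewrite powR_inv1.
Qed.

Let Vr_ge0 x : 0 <= (r x)^-1. Proof. by rewrite invr_ge0. Qed.

Let mdivr f : cmeasurable f -> cmeasurable (divr f).
Proof. by apply: cmeasurableM; exact: cmeasurable_real. Qed.

(** The identity [<w (f \o phi), w (k \o phi)> = <f, r k>], at [k = F / r]:
    the adjoint sends the quotient of [F] back to [F], up to the part of [F]
    on [r = 0]. *)
Lemma wquot_adjoint F U V : wquot (F, U) ->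
  {ae mu, forall x, V x = if 0 < r x then F x else 0} ->
  adjoint (L2dot mu) T (U, V).
Proof.
move=> /= FU FV f g /= fg.
pose k x := L2repr f x * Num.conj (divr F x).
have mk : cmeasurable k.
  apply: cmeasurableM; first exact: cmeasurable_L2.
  by apply/cmeasurable_conj/mdivr; exact: cmeasurable_L2.
pose wk x := (normc (w x) ^+ 2)%:C * k (phi x).
rewrite (@L2ipE _ _ _ _ _ _ wk); first last.
- apply: filterS2 fg FU => x -> ->.
  by rewrite /wk normc_sqr /k /divr rmorphM mulrACA.
- apply: cmeasurableM; last exact: cmeasurable_comp.
  by apply: cmeasurable_real; exact/measurable_EFinP.
rewrite cintegral_pullback//; apply/esym/L2ipE.
  by apply: cmeasurableM => //; exact: cmeasurable_real.
apply: filterS FV => x ->; rewrite /k /divr.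
have [rx|rx] := ltP 0 (r x); last first.
  have -> : r x = 0 by apply/eqP; rewrite eq_le rx r0.
  by rewrite rmorph0 mulr0 mul0r.
have conjR (a : R) : Num.conj a%:C = a%:C by exact: conjc_real.
have rV : (r x)%:C * ((r x)^-1)%:C = 1.
  by rewrite -[LHS](rmorphM (real_complex R)) divff ?gt_eqF.
by rewrite rmorphM/= conjR mulrCA [(r x)%:C * _]mulrA rV mul1r.
Qed.

Let integral_wquot F :
  (\int[mu]_x (normc (w x * divr F (phi x)) ^+ 2)%:E =
   \int[mu]_x ((r x)^-1 * normc (F x) ^+ 2)%:E)%E.
Proof.
have mdF := mdivr (cmeasurable_L2 F).
rewrite (integral_pullback_normc2 mdF); apply: eq_integral => x _.
congr EFin; rewrite /divr normcM exprMn mulrA; congr (_ * _).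
rewrite normc2E/= expr0n addr0.
have [->|rx] := eqVneq (r x) 0; first by rewrite mul0r invr0.
by rewrite expr2 mulVKf.
Qed.

Let mwdivr F : cmeasurable (fun x => w x * divr F (phi x)).
Proof.
apply: cmeasurableM => //; apply: cmeasurable_comp => //; apply: mdivr.
exact: cmeasurable_L2.
Qed.

Lemma wquot_sqnorm F U : wquot (F, U) -> L2dot mu U U =
  (fine (\int[mu]_x ((r x)^-1 * normc (F x) ^+ 2)%:E))%:C.
Proof. by move=> FU; rewrite (L2_sqnormE (mwdivr F) FU) integral_wquot. Qed.

Lemma wquot_exists F : (\int[mu]_x ((r x)^-1 * normc (F x) ^+ 2)%:E < +oo)%E ->
  exists U, wquot (F, U).
Proof.
move=> Foo.
suff : sqint mu (fun x => w x * divr F (phi x)) by move=> /L2_exists.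
by split; [exact: mwdivr|rewrite integral_wquot].
Qed.

(** On [n.+1%:R^-1 <= r] division by [r] is bounded, so that the truncation
    [V] of [F] to this set is in the domain of the quotient and its image [U]
    is in the range of [T]. *)
Lemma wquot_truncate F n : exists K U V, [/\ T (K, U), wquot (V, U),
  {ae mu, forall x, K x = ((r x)^-1)%:C * V x} &
  {ae mu, forall x, V x = if n.+1%:R^-1 <= r x then F x else 0}].
Proof.
have mD : measurable_fun setT (fun x => n.+1%:R^-1 <= r x).
  exact: measurable_fun_ler.
have [V FV] := L2_exists (sqint_if mD (sqint_L2 F)).
have le_inv : {ae mu, forall x, V x = 0 \/ (r x)^-1 <= n.+1%:R}.
  apply: filterS FV => x ->; case: ifPn => [nr|_]; [right|by left].
  by rewrite -[leRHS]invrK lef_pV2 ?posrE ?invr_gt0// (lt_le_trans _ nr).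
have [U VU] : exists U, wquot (V, U).
  by apply/wquot_exists/(L2_bounded_weight (B := n.+1%:R)).
have [K KV] : exists K : L2 mu, {ae mu, forall x, K x = ((r x)^-1)%:C * V x}.
  apply: L2_exists; split; first by apply: mdivr; exact: cmeasurable_L2.
  under eq_integral do rewrite normcM exprMn.
  apply: (L2_bounded_weight (B := n.+1%:R ^+ 2)); rewrite ?sqr_ge0//.
  - apply/measurable_EFinP/measurable_normc2; exact: cmeasurable_real.
  - by move=> x; rewrite sqr_ge0.
  apply: filterS le_inv => x [->|rn]; [by left|right].
  by rewrite /= expr0n addr0 sqr_sqrtr ?sqr_ge0// lerXn2r ?nnegrE.
exists K, U, V; split => //=.
by apply: filterS2 VU (pullback_ae KV) => x /= -> [->|->//]; rewrite !mul0r.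
Qed.

Lemma supp_exists F :
  exists V, {ae mu, forall x, V x = if 0 < r x then F x else 0}.
Proof.
apply: (L2_exists (sqint_if _ (sqint_L2 F))).
by apply: measurable_fun_ltr.
Qed.

(** The class [V] is the orthogonal projection of [F] onto the closed range of
    the adjoint, and [F - V] its part orthogonal to this range. *)
Lemma supp_ker F V : {ae mu, forall x, V x = if 0 < r x then F x else 0} ->
  op_ker T (F - V).
Proof.
move=> FV; rewrite /op_ker /T /wcomp/=.
have : {ae mu, forall x, r x <= 0 \/ L2repr (F - V) x = 0}.
  apply: filterS2 (L2reprB F V) FV => x -> ->.
  by have [rx|rx] := ltP 0 (r x); [right; rewrite subrr|left].
move=> /pullback_ae FV0.
apply: filterS3 (L2repr0 mu) FV0 pullback_density_gt0 => x ->.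
move=> [->|[rx|->]]; rewrite ?mul0r ?mulr0// => -[->|]; rewrite ?mul0r//.
by rewrite ltNge rx.
Qed.

Let ran := op_ran (adjoint (L2dot mu) T).

(** Each truncation of [F] to [n.+1%:R^-1 <= r] is the value of the adjoint at
    its quotient. *)
Lemma supp_hclosure F V : {ae mu, forall x, V x = if 0 < r x then F x else 0} ->
  hclosure (L2dot mu) ran V.
Proof.
move=> FV e e0.
have V0 : {ae mu, forall x, V x = 0 \/ 0 < r x}.
  by apply: filterS FV => x ->; case: ifPn => _; [right|left].
have [n Vn] := L2_truncate mr V0 e0.
have [K [U [W [_ WU _ WV]]]] := wquot_truncate V n.
exists W; last exact: Vn.
exists U; apply: (wquot_adjoint WU).
apply: filterS WV => x Wx; case: ifPn => //; rewrite Wx => rx.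
by case: ifPn => // nr; move: rx; rewrite (lt_le_trans _ nr).
Qed.

(** For a closed densely defined operator this follows from [T** = T]; here it
    follows from the explicit elements of the range found in [supp_hclosure]. *)
Lemma orthcompl_ran_adjoint : orthcompl (L2dot mu) ran = op_ker T.
Proof.
apply/seteqP; split => F; last by move=> TF v; exact: ker_adjoint_ran.
move=> Fran; have [V FV] := supp_exists F.
have Vran := supp_hclosure FV; have kFV := supp_ker FV.
have FV0 : L2dot mu (F - V) V = 0.
  apply: orthcompl_hclosure Vran => v; exact: ker_adjoint_ran kFV.
have V0 : V = 0.
  apply/eqP; rewrite -(dnorm_eq0 (L2dot mu)); apply/eqP.
  have := FV0; rewrite linearBl/= (orthcompl_hclosure Fran Vran) sub0r.
  by move/eqP; rewrite oppr_eq0 => /eqP.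
by move: kFV; rewrite V0 subr0.
Qed.

Lemma wquot_proj F U : wquot (F, U) ->
  exists2 V, adjoint (L2dot mu) T (U, V) &
    orthproj (L2dot mu) (hclosure (L2dot mu) ran) F V.
Proof.
move=> FU; have [V FV] := supp_exists F.
exists V; first exact: wquot_adjoint FU FV.
split; first exact: supp_hclosure FV.
by apply: orthcompl_hclosure; rewrite orthcompl_ran_adjoint; exact: supp_ker.
Qed.

(** The quotients of the truncations of [F] are in the range of [T], and they
    are truncations of [U]. *)
Lemma wquot_hclosure F U : wquot (F, U) ->
  hclosure (L2dot mu) (op_ran T) U.
Proof.
move=> FU e e0.
have U0 : {ae mu, forall x, U x = 0 \/ 0 < r (phi x)}.
  apply: filterS2 FU pullback_density_gt0 => x /= -> [->|]; last by right.
  by rewrite mul0r; left.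
have [n Un] := L2_truncate (measurableT_comp mr mphi) U0 e0.
have [K [W [V [KW VW _ FV]]]] := wquot_truncate F n.
exists W; first by exists K.
apply: Un; apply: filterS3 FU VW (pullback_ae FV) => x /= -> ->.
by move=> [->|->]; [rewrite !mul0r if_same|case: ifP; rewrite // !mulr0].
Qed.

Lemma wquot_orth_ker_adjoint F U : wquot (F, U) ->
  orthcompl (L2dot mu) (op_ker (adjoint (L2dot mu) T)) U.
Proof.
move=> /wquot_hclosure FU z Tz; apply: ip_sym0.
apply: orthcompl_hclosure FU => g [f fg]; apply: ip_sym0.
by rewrite (Tz _ _ fg)/= linear0r.
Qed.

Let mtrunc n V : measurable_fun setT (fun x =>
  (if n.+1%:R^-1 <= r x then (r x)^-1 * normc (V x) ^+ 2 else 0)%:E).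
Proof.
apply/measurable_EFinP/measurable_fun_ifT => //.
  exact: measurable_fun_ler.
apply: measurable_funM => //.
exact/measurable_EFinP/measurable_normc2/cmeasurable_L2.
Qed.

(** If [V = T* G], the quotient [U] of the truncation of [V] is [T K] for some
    [K], and [<U, G> = <K, V> = <U, U>]; hence [|U| <= |G|]. *)
Lemma adjoint_quotient_bound G V n : adjoint (L2dot mu) T (G, V) ->
  (\int[mu]_x (if n.+1%:R^-1 <= r x then (r x)^-1 * normc (V x) ^+ 2 else 0)%:E
   <= \int[mu]_x (normc (G x) ^+ 2)%:E)%E.
Proof.
move=> GV; have [K [U [W [KU WU KW VW]]]] := wquot_truncate V n.
have UW : adjoint (L2dot mu) T (U, W).
  apply: (wquot_adjoint WU); apply: filterS VW => x ->.
  case: ifPn => [nr|_]; last by rewrite if_same.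
  by rewrite (lt_le_trans _ nr)// invr_gt0.
have KVW : L2dot mu K V = L2dot mu K W.
  apply: cmeasurable_ae_cintegral.
  - by apply: cmeasurableM; [|apply: cmeasurable_conj]; exact: cmeasurable_L2.
  - by apply: cmeasurableM; [|apply: cmeasurable_conj]; exact: cmeasurable_L2.
  by apply: filterS2 KW VW => x -> ->; case: ifPn; rewrite // mulr0 !mul0r.
have : L2dot mu U (G - U) = 0.
  by rewrite linearBr/= (GV _ _ KU) (UW _ _ KU)/= KVW subrr.
move=> /ip_proj_le; rewrite (wquot_sqnorm WU).
rewrite (L2_sqnormE (cmeasurable_L2 G)); last exact: nearW.
rewrite lecR => fine_le.
have Woo := L2_sqnorm_fin (mwdivr W) WU; rewrite integral_wquot in Woo.
have [_ Goo] := sqint_L2 G.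
have mW := measurable_normc2 (cmeasurable_L2 W).
rewrite (_ : (\int[mu]_x _)%E = \int[mu]_x ((r x)^-1 * normc (W x) ^+ 2)%:E)%E.
  move: fine_le; rewrite -lee_fin !fineK// ge0_fin_numE// integral_ge0// => x _.
    by rewrite lee_fin sqr_ge0.
  by rewrite lee_fin mulr_ge0// sqr_ge0.
apply: ae_eq_integral => //.
  by apply/measurable_EFinP/measurable_funM => //; exact/measurable_EFinP.
by apply: filterS VW => x -> _; case: ifP => // _; rewrite normc0 expr0n mulr0.
Qed.

(** The bounds of [adjoint_quotient_bound] are uniform in [n], and monotone
    convergence removes the truncation. *)
Lemma adjoint_wquot G V : adjoint (L2dot mu) T (G, V) -> exists U, wquot (V, U).
Proof.
move=> GV; apply: wquot_exists; have [_ Goo] := sqint_L2 G.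
apply: le_lt_trans Goo; pose f n x := (if n.+1%:R^-1 <= r x
  then (r x)^-1 * normc (V x) ^+ 2 else 0)%:E.
have f_cvg x : f n x @[n --> \oo] --> ((r x)^-1 * normc (V x) ^+ 2)%:E.
  apply: cvg_near_cst; have [rx|rx] := ltP 0 (r x).
    by apply: filterS (near_inv_le rx) => n nr; rewrite /f nr.
  have rx0 : r x = 0 by apply/eqP; rewrite eq_le rx r0.
  by rewrite rx0; apply: nearW => n; rewrite /f rx0 invr0 mul0r if_same.
rewrite (_ : (\int[mu]_x _)%E = \int[mu]_x limn (f^~ x))%E; last first.
  by apply: eq_integral => x _; apply/esym/cvg_lim.
have int_cvg : (\int[mu]_x f n x @[n --> \oo] --> \int[mu]_x limn (f^~ x))%E.
  apply: cvg_monotone_convergence => //.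
  - by move=> n; exact: mtrunc.
  - move=> n x _; rewrite lee_fin; case: ifP => // _.
    by rewrite mulr_ge0// sqr_ge0.
  - move=> x _ m n mn; rewrite lee_fin; case: ifP => [mr'|_]; last first.
      by case: ifP => // _; rewrite mulr_ge0// sqr_ge0.
    by rewrite ifT// (le_trans _ mr')// lef_pV2 ?posrE// ler_nat ltnS.
rewrite -(cvg_lim _ int_cvg)//; apply: lime_le; first exact: cvgP int_cvg.
by apply: nearW => n; exact: adjoint_quotient_bound.
Qed.

Lemma wquot_lin (a : R[i]) p q : wquot p -> wquot q -> wquot (a *: p + q).
Proof.
case: p q => [F U] [G V] /= FU GV.
have FG := pullback_ae (L2repr_lin a F G).
rewrite /wquot/=; near=> x.
have -> : L2repr (a *: U + V) x = a * U x + V x by near: x; exact: L2repr_lin.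
have -> : U x = w x * (((r (phi x))^-1)%:C * F (phi x)) by near: x.
have -> : V x = w x * (((r (phi x))^-1)%:C * G (phi x)) by near: x.
have [->|->] : w x = 0 \/
    L2repr (a *: F + G) (phi x) = a * F (phi x) + G (phi x) by near: x.
  by rewrite !mul0r mulr0 addr0.
by rewrite !mulrDr mulrCA [a * (_ * _)]mulrCA.
Unshelve. all: by end_near. Qed.

Lemma op_ker_wquot : op_ker wquot = op_ker T.
Proof.
apply/seteqP; split => F; rewrite /op_ker/= => F0.
  apply: filterS3 (L2repr0 mu) F0 pullback_density_gt0.
  move=> x /= -> + [->|rx]; first by rewrite !mul0r.
  move=> /eqP; rewrite mulrCA eq_sym mulf_eq0 => /orP[|/eqP->//].
  by rewrite (fmorph_eq0 (real_complex R)) invr_eq0 gt_eqF.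
apply: filterS2 F0 (L2repr0 mu) => x /= -> /eqP.
by rewrite mulf_eq0 => /orP[]/eqP->; rewrite ?mul0r ?mulr0.
Qed.

(** The domain is the range plus its orthogonal complement: [wquot_proj] splits
    each element of the domain, [adjoint_wquot] puts the range into the domain,
    and the orthogonal complement is the kernel of the quotient. *)
Lemma wquot_reciprocal : hdense (L2dot mu) (op_dom T) ->
  is_reciprocal (L2dot mu) (adjoint (L2dot mu) T) wquot.
Proof.
move=> dT.
have domE : op_dom wquot = hsum ran (orthcompl (L2dot mu) ran).
  apply/seteqP; split => [F [U FU]|_ [V [G GV] [F Fran <-]]].
    have [V UV [_ FV]] := wquot_proj FU.
    exists V; first by exists U.
    exists (F - V); last by rewrite addrC subrK.
    by move=> v vran; apply: FV; exact: sub_hclosure.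
  have [U VU] := adjoint_wquot GV.
  move: Fran; rewrite orthcompl_ran_adjoint -op_ker_wquot => F0.
  exists (U + 0); have := wquot_lin 1 VU F0.
  by rewrite scale1r.
split => //.
- split.
    split; last 1 first.
    + by move=> F U V /= FU FV; apply/L2P; apply: filterS2 FU FV => x /= -> ->.
    + rewrite /wquot/=; have := pullback_ae (L2repr0 mu).
      by apply: filterS2 (L2repr0 mu) => x -> [->|->]; rewrite ?mul0r ?mulr0.
    + exact: wquot_lin.
  apply/seteqP; split => // F _ e e0.
  have [V FV] := supp_exists F.
  have [v vran Vv] := supp_hclosure FV e0.
  (* [V] is approximated from the range; [F - V] stays in the domain *)
  exists (v + (F - V)); last by rewrite addrC opprD opprB addrA subrK addrC.
  rewrite domE; exists v => //; exists (F - V) => //.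
  by rewrite orthcompl_ran_adjoint; exact: supp_ker.
- by move=> F U; exact: wquot_proj.
- move=> G V GV; have [U VU] := adjoint_wquot GV.
  exists U => //; split; first exact: wquot_orth_ker_adjoint VU.
  have [V' UV' VV'] := wquot_proj VU.
  have V'V : V' = V.
    apply: orthproj_uniq VV' _; split; first by apply: sub_hclosure; exists G.
    by move=> v _; rewrite subrr linear0l.
  rewrite V'V in UV'.
  have GU : op_ker (adjoint (L2dot mu) T) (G - U).
    have := adjoint_lin (-1) UV' GV.
    rewrite -[X in adjoint _ _ X]/(-1 *: U + G, -1 *: V + V).
    by rewrite !scaleN1r addNr addrC.
  by move=> z zT; apply: ip_sym0; exact: zT.
- by rewrite op_ker_wquot -orthcompl_ran_adjoint.
Qed.

End PullbackDensity.

(** * Densities in the extended real numbers *)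

Section Finiteness.
Context d (X : measurableType d) (R : realType).
Variables (mu : {sigma_finite_measure set X -> \bar R}) (phi : X -> X).
Variables (w : X -> R[i]) (H : X -> \bar R).
Hypotheses (mphi : measurable_fun setT phi) (mw : cmeasurable w)
  (mH : measurable_fun setT H) (H0 : forall x, (0 <= H x)%E).
Hypothesis wH : forall A, measurable A ->
  (\int[mu]_(x in phi @^-1` A) (normc (w x) ^+ 2)%:E = \int[mu]_(x in A) H x)%E.

Let T := wcomp mu phi w.

(** The integral of [H |G|^2] is the squared norm of [w (G \o phi)]. *)
Lemma op_dom_wcomp0 (G : L2 mu) : op_dom T G ->
  {ae mu, forall x, H x = +oo%E -> G x = 0}.
Proof.
move=> [K GK]; have mG := cmeasurable_L2 G.
pose f x := (H x * (normc (G x) ^+ 2)%:E)%E.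
have f0 x : (0 <= f x)%E by rewrite mule_ge0// lee_fin sqr_ge0.
have foo : (\int[mu]_x f x < +oo)%E.
  have mw2 := measurable_normc2 mw.
  rewrite -(ge0_integral_image_density mphi mw2 mH _ H0 wH)//.
  - under eq_integral do rewrite -EFinM -exprMn -normcM.
    apply: L2_sqnorm_fin GK; apply: cmeasurableM => //.
    exact: cmeasurable_comp.
  - by move=> x; rewrite lee_fin sqr_ge0.
  - exact: measurable_normc2.
  - by move=> x; rewrite lee_fin sqr_ge0.
have intf : mu.-integrable setT f.
  apply/integrableP; split.
    by apply: emeasurable_funM => //; exact: measurable_normc2.
  by under eq_integral do rewrite gee0_abs//.
have := integrable_ae measurableT intf; apply: filterS => x /(_ I) + Hx.
rewrite /f Hx; have [/eq0_normc->//|Gx] := eqVneq (normc (G x)) 0.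
by rewrite gt0_mulye// lte_fin exprn_even_gt0.
Qed.

(** By [op_dom_wcomp0] the elements of the domain vanish on [H = +oo], hence
    are orthogonal to the indicators of the pieces of finite measure of this
    set. *)
Lemma density_fin_num : hdense (L2dot mu) (op_dom T) ->
  {ae mu, forall x, H x \is a fin_num}.
Proof.
move=> dT; have [F FT F_fin] := sigma_finiteT mu.
pose Z n := F n `&` H @^-1` [set +oo%E].
have mZ n : measurable (Z n).
  apply: measurableI; first by case: (F_fin n).
  by apply: (measurable_preimage mH); exact: emeasurable_set1.
have Z_null n : {ae mu, forall x, ~ Z n x}.
  have sqZ : sqint mu (fun x => (\1_(Z n) x)%:C%C).
    split; first by apply: cmeasurable_real; exact: measurable_indic.
    have [mF Foo] := F_fin n.
    rewrite (_ : (\int[mu]_x _)%E = mu (Z n)).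
      apply: le_lt_trans Foo; apply: le_measure; rewrite ?inE//.
      exact: subIsetl.
    transitivity (\int[mu]_x (\1_(Z n) x)%:E)%E.
      2: by rewrite integral_indic// setIT.
    apply: eq_integral => x _.
    rewrite normc2E/= indicE expr0n addr0.
    by case: (x \in _); rewrite ?expr1n ?expr0n.
  have [I IZ] := L2_exists sqZ.
  have I0 : I = 0.
    apply: (hdense_orthcompl0 dT) => G /op_dom_wcomp0 G0.
    rewrite (@L2ipE _ _ _ _ _ _ (fun=> 0)).
    - by rewrite /cintegral/= /Rintegral !integral0.
    - by split; exact: measurable_cst.
    apply: filterS2 G0 IZ => x Gx ->; rewrite indicE.
    case: (boolP (x \in _)) => [|_]; last by rewrite mul0r.
    by rewrite inE => -[_ /Gx ->]; rewrite rmorph0 mulr0.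
  move: IZ; rewrite I0 => IZ.
  apply: filterS2 IZ (L2repr0 mu) => x -> + Zx.
  rewrite indicE mem_set// => /(congr1 (@complex.Re R))/= /eqP.
  by rewrite oner_eq0.
have := ae_foralln Z_null; apply: filterS => x nZ.
have [n _ Fnx] : (\bigcup_i F i) x by rewrite -FT.
rewrite ge0_fin_numE// ltey; apply/eqP => Hx; exact: (nZ n).
Qed.

End Finiteness.

(** By [preimage_measurable_factor] the conditional expectation is [e \o phi];
    then [H = h e], since [h] is the density of the image of [mu]. *)
Lemma comp_density d (X : measurableType d) (R : realType)
  (mu : {measure set X -> \bar R}) (phi : X -> X) (w : X -> R[i])
  (h E : X -> \bar R) : measurable_fun setT phi -> cmeasurable w ->
  is_RN_comp mu phi h ->
  is_condexp mu phi (fun x => (normc (w x) ^+ 2)%:E) E ->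
  exists H : X -> \bar R, [/\ measurable_fun setT H, forall x, (0 <= H x)%E,
    forall A, measurable A ->
      (\int[mu]_(x in phi @^-1` A) (normc (w x) ^+ 2)%:E =
       \int[mu]_(x in A) H x)%E &
    forall x, (h (phi x) * E x = H (phi x))%E].
Proof.
move=> mphi mw [mh h0 hE] [mE E0 EE].
have [e [me e0 Ee]] := preimage_measurable_factor mE E0.
exists (fun x => h x * e x)%E; split.
- exact: emeasurable_funM.
- by move=> x; exact: mule_ge0.
- move=> A mA; rewrite -EE//.
  have meA : measurable_fun setT (e \_ A).
    by apply/(measurable_restrictT e) => //; exact: measurable_funS me.
  have eA0 x : (0 <= (e \_ A) x)%E by rewrite patchE; case: ifP.
  have h1 B : measurable B -> (\int[mu]_(x in phi @^-1` B) cst 1 x =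
      \int[mu]_(x in B) h x)%E.
    move=> mB; rewrite integral_cst ?mul1e ?hE//.
    exact: measurable_preimage.
  have := ge0_integral_image_density mphi (measurable_cst 1%E) mh
    (fun=> lee01) h0 h1 meA eA0.
  move=> eAE; rewrite Ee integral_mkcond [RHS]integral_mkcond.
  transitivity (\int[mu]_x (cst 1 x * (e \_ A) (phi x)))%E.
    by apply: eq_integral => x _; rewrite mul1e !patchE.
  rewrite eAE; apply: eq_integral => x _; rewrite !patchE.
  by case: ifP => // _; rewrite mule0.
- by move=> x; rewrite Ee.
Qed.

(** At almost every point either [w = 0], and both conditions say that [G = 0]
    (with [0 * +oo = 0]), or the denominator is a positive real number. *)
Lemma is_wquotientE d (X : measurableType d) (R : realType)
  (mu : {measure set X -> \bar R}) (phi : X -> X) (w : X -> R[i])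
  (h E H : X -> \bar R) (F G : L2 mu) :
  (forall x, 0 <= H x)%E -> (forall x, (h (phi x) * E x = H (phi x))%E) ->
  {ae mu, forall x, w x = 0 \/ 0 < fine (H (phi x))} ->
  is_wquotient phi w h E F G <-> wquot phi w (fun x => fine (H x)) (F, G).
Proof.
move=> H0 hEH Hpos.
have pointwise : {ae mu, forall x,
    (((complex.Re (G x))%:E =
      ((complex.Re (w x * F (phi x))%R)%:E / (h (phi x) * E x))%E /\
    (complex.Im (G x))%:E =
      ((complex.Im (w x * F (phi x))%R)%:E / (h (phi x) * E x))%E)) <->
    G x = w x * (((fine (H (phi x)))^-1)%:C%C * F (phi x))}.
  apply: filterS Hpos => x; rewrite hEH => -[->|].
    rewrite !mul0r /= !mul0e; case: (G x) => a b /=.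
    by split=> [[[->] [->]]|[-> ->]].
  move: (H (phi x)) (H0 (phi x)) => [s| |]//= _ s0; last by rewrite ltxx in s0.
  rewrite inver gt_eqF// mulrCA; case: (G x) (w x * _) => [a b] [p q] /=.
  have -> : (s^-1)%:C%C * Complex p q = Complex (p / s) (q / s).
    rewrite -[LHS]/(Complex (s^-1 * p - 0 * q) (s^-1 * q + 0 * p)).
    by rewrite !mul0r subr0 addr0 ![s^-1 * _]mulrC.
  by rewrite -!EFinM; split=> [[[->] [->]]|[-> ->]].
split=> [q|q]; rewrite /wquot/= in q *; by apply: filterS2 pointwise q => x [] .
Qed.

Theorem corollary7 (R : realType) (d : measure_display) (X : measurableType d)
  (mu : {sigma_finite_measure set X -> \bar R})
  (phi : X -> X) (w : X -> R[i]) (h E : X -> \bar R)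
  (mphi : measurable_fun setT phi) (mw : cmeasurable w)
  (dC1 : wcomp_densely_defined mu phi (fun _ => 1))
  (dCw : wcomp_densely_defined mu phi w)
  (hRN : is_RN_comp mu phi h)
  (hE : is_condexp mu phi (fun x => (normc (w x) ^+ 2)%:E) E) :
  let T := reciprocal (L2dot mu) (adjoint (L2dot mu) (wcomp mu phi w)) in
  op_dom T = [set F | exists G, is_wquotient phi w h E F G] /\
  (forall F G : L2 mu, T (F, G) -> is_wquotient phi w h E F G).
Proof.
have [H [mH H0 wH hEH]] := comp_density mphi mw hRN hE.
have [_ dT] := dCw; have Hfin := density_fin_num mphi mw mH H0 wH dT.
pose r x := fine (H x).
have mr : measurable_fun setT r by exact: measurableT_comp.
have r0 x : 0 <= r x by exact: fine_ge0.
have wr A : measurable A ->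
    (\int[mu]_(x in phi @^-1` A) (normc (w x) ^+ 2)%:E =
     \int[mu]_(x in A) (r x)%:E)%E.
  move=> mA; rewrite wH//; apply: ae_eq_integral => //.
  - exact: measurable_funS mH.
  - by apply/measurable_EFinP; exact: measurable_funS mr.
  - by apply: filterS Hfin => x Hx _; rewrite fineK.
have rpos := pullback_density_gt0 mphi mw mr r0 wr.
have quotP F G := is_wquotientE F G H0 hEH rpos.
move=> T.
have -> : T = wquot phi w r.
  have recip := wquot_reciprocal mphi mw mr r0 wr dT.
  apply: reciprocal_uniq (recip).
    move=> p q Tp Tq; rewrite addrC -scaleN1r; exact: adjoint_lin.
  exact: (xgetPex set0 (ex_intro _ _ recip)).
split=> [|F G /quotP//].
by apply/seteqP; split => F [G /quotP FG]; exists G.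
Qed.
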